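(* Let $\varepsilon>0$, let $\rho(x)=|x|$ on $\mathbb R$, let $\psi_\varepsilon$ be the biweight kernel $$\psi_\varepsilon(t)=\begin{cases}\dfrac{15}{16\varepsilon}\big(1-(t/\varepsilon)^2\big)^2,&|t|\le\varepsilon,\\[4pt]0,&|t|>\varepsilon,\end{cases}$$ and let $\tilde\rho_\varepsilon(x)=\int_{-\infty}^{\infty}\psi_\varepsilon(x-y)\,\rho(y)\,dy$ for $x\in\mathbb R$. Then $$\tilde\rho_\varepsilon(x)=\begin{cases}\dfrac{5\varepsilon}{16}+\dfrac{15x^2}{16\varepsilon}-\dfrac{5x^4}{16\varepsilon^3}+\dfrac{x^6}{16\varepsilon^5},&|x|<\varepsilon,\\[6pt]|x|,&|x|\ge\varepsilon.\end{cases}$$ Moreover, $\tilde\rho_\varepsilon\in C^3(\mathbb R)$, $\tilde\rho_\varepsilon$ is convex on all of $\mathbb R$, and $\tilde\rho_\varepsilon$ matches $\rho(x)=|x|$, together with its first three derivatives, exactly at the points $x=\pm\varepsilon$. Furthermore, $$\tilde\rho_\varepsilon(0)=\tfrac{5}{16}\varepsilon>0,\qquad \tilde\rho_\varepsilon'(0)=0,\qquad \tilde\rho_\varepsilon''(0)=\tfrac{15}{8\varepsilon}>0,\qquad \tilde\rho_\varepsilon''(x)=2\psi_\varepsilon(x)\ge 0\ \text{ for all }x\in\mathbb R.$$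
   Context: No further definitions are needed. ''Matches together with its first three derivatives at $x=\pm\varepsilon$'' means $\tilde\rho_\varepsilon^{(k)}(\pm\varepsilon)=\rho^{(k)}(\pm\varepsilon)$ for $k=0,1,2,3$. *)

(* Defs.v *)
From Stdlib Require Import Reals.
From Coquelicot Require Import Coquelicot.

Open Scope R_scope.

Definition rho (x : R) : R := Rabs x.

Definition biweight (eps t : R) : R :=
  if Rle_dec (Rabs t) eps
  then 15 / (16 * eps) * (1 - (t / eps) ^ 2) ^ 2
  else 0.

Definition conv_integrand (eps x y : R) : R := biweight eps (x - y) * rho y.

(* The integral over the real line is an improper Riemann integral, with both
   bounds tending to infinity independently. For the nonnegative integrand
   used here it has the same meaning as the Lebesgue integral. [RInt_gen] is
   total, so convergence has to be asserted separately. *)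
Definition rho_tilde (eps x : R) : R :=
  RInt_gen (conv_integrand eps x) (Rbar_locally m_infty) (Rbar_locally p_infty).

Definition class_C (n : nat) (f : R -> R) : Prop :=
  forall k : nat, (k <= n)%nat ->
  forall x : R, ex_derive_n f k x /\ continuous (Derive_n f k) x.

Definition convex_on_R (f : R -> R) : Prop :=
  forall x y t : R, 0 <= t <= 1 ->
  f (t * x + (1 - t) * y) <= t * f x + (1 - t) * f y.

(* [Derive_n] is total: the first conjunct ensures that the derivatives that
   are compared are genuine. Differentiability is required on a neighbourhood
   because [ex_derive_n f k a] alone says nothing about the existence of the
   lower-order derivatives near [a]. *)
Definition matches_to_order (n : nat) (f g : R -> R) (a : R) : Prop :=
  locally a (fun x : R => forall k : nat, (k <= n)%nat ->
    ex_derive_n f k x /\ ex_derive_n g k x) /\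
  (forall k : nat, (k <= n)%nat -> Derive_n f k a = Derive_n g k a).

(* Main.v *)
(* The kernel is supported in [-eps, eps], so the convolution is an integral of
   a piecewise polynomial with a single possible breakpoint at y = 0, and it has
   an explicit antiderivative. The resulting function glues -x, a sextic and x at
   -eps and eps; the values and the first three derivatives of adjacent
   pieces agree there, so the glued function is C^3 with derivatives obtained
   piecewise. Its second derivative is 2 psi_eps >= 0, which gives convexity. *)
Require Import Defs.
From Stdlib Require Import Reals Lra Lia.
From Coquelicot Require Import Coquelicot.

Open Scope R_scope.

(** * Gluing two functions at a point *)

Definition glue (a : R) (g h : R -> R) (x : R) : R :=
  if Rle_dec x a then g x else h x.

Lemma glue_left (a : R) (g h : R -> R) (x : R) : x <= a -> glue a g h x = g x.
Proof. intros H; unfold glue; destruct (Rle_dec x a); [reflexivity | lra]. Qed.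

Lemma glue_right (a : R) (g h : R -> R) (x : R) : a < x -> glue a g h x = h x.
Proof. intros H; unfold glue; destruct (Rle_dec x a); [lra | reflexivity]. Qed.

Lemma continuous_glue (a : R) (g h : R -> R) :
  g a = h a -> (forall x, continuous g x) -> (forall x, continuous h x) ->
  forall x, continuous (glue a g h) x.
Proof.
intros E Cg Ch x.
destruct (Rtotal_order x a) as [H | [-> | H]].
- apply (continuous_ext_loc _ g); [ | apply Cg].
  apply filter_imp with (2 := open_lt a x H).
  intros y Hy; symmetry; apply glue_left; lra.
(* The common value [g a = h a] lies in [P], so near [a] both pieces take values in [P], whichever
   of them is selected. *)
- intros P HP.
  rewrite glue_left in HP by lra.
  assert (HPh := HP); rewrite E in HPh.
  change (locally a (fun y => P (glue a g h y))).
  apply filter_imp with (P := fun y => P (g y) /\ P (h y));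
    [ | apply filter_and; [now apply Cg | now apply Ch]].
  intros y [Hg Hh].
  unfold glue; destruct (Rle_dec y a); assumption.
- apply (continuous_ext_loc _ h); [ | apply Ch].
  apply filter_imp with (2 := open_gt a x H).
  intros y Hy; symmetry; apply glue_right; lra.
Qed.

(** Away from [a] the glued function is locally one of the pieces. At [a] its difference quotient is
    that of [g] for negative increments and that of [h] for positive ones, with the same limit, so
    the smaller of the two radii works. *)
Lemma is_derive_glue (a : R) (g h g' h' : R -> R) :
  g a = h a -> g' a = h' a ->
  (forall x, is_derive g x (g' x)) -> (forall x, is_derive h x (h' x)) ->
  forall x, is_derive (glue a g h) x (glue a g' h' x).
Proof.
intros E E' Dg Dh x.
destruct (Rtotal_order x a) as [H | [-> | H]].
- rewrite glue_left by lra.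
  apply (is_derive_ext_loc g); [ | apply Dg].
  apply filter_imp with (2 := open_lt a x H).
  intros y Hy; symmetry; apply glue_left; lra.
- rewrite glue_left by lra.
  apply is_derive_Reals; intros e He.
  assert (Dga := Dg a); assert (Dha := Dh a).
  apply is_derive_Reals in Dga; apply is_derive_Reals in Dha.
  destruct (Dga e He) as [d1 H1]; destruct (Dha e He) as [d2 H2].
  assert (Hd : 0 < Rmin d1 d2) by (apply Rmin_pos; apply cond_pos).
  exists (mkposreal _ Hd); intros k Hk0 Hk; simpl in Hk.
  rewrite (glue_left a g h a) by lra.
  unfold glue; destruct (Rle_dec (a + k) a).
  + apply H1; [ | apply Rlt_le_trans with (1 := Hk), Rmin_l]; assumption.
  + rewrite E, E'.
    apply H2; [ | apply Rlt_le_trans with (1 := Hk), Rmin_r]; assumption.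
- rewrite glue_right by lra.
  apply (is_derive_ext_loc h); [ | apply Dh].
  apply filter_imp with (2 := open_gt a x H).
  intros y Hy; symmetry; apply glue_right; lra.
Qed.

(** * Explicit sequences of successive derivatives *)

(** Listing the derivatives in closed form reduces every claim about [Derive_n] and [ex_derive_n] to
    first-order [is_derive] facts. *)
Definition derivative_chain (n : nat) (F : nat -> R -> R) : Prop :=
  forall (k : nat) (x : R), (k < n)%nat -> is_derive (F k) x (F (S k) x).

Lemma Derive_n_chain (n : nat) (F : nat -> R -> R) :
  derivative_chain n F ->
  forall k, (k <= n)%nat -> forall x, Derive_n (F 0%nat) k x = F k x.
Proof.
intros HF k; induction k as [ | k IH]; intros Hk x; [reflexivity | ].
simpl; rewrite (Derive_ext _ (F k)) by (intros; apply IH; lia).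
apply is_derive_unique, HF; lia.
Qed.

Lemma ex_derive_n_chain (n : nat) (F : nat -> R -> R) :
  derivative_chain n F ->
  forall k, (k <= n)%nat -> forall x, ex_derive_n (F 0%nat) k x.
Proof.
intros HF [ | k] Hk x; [exact I | ].
simpl; apply (ex_derive_ext (F k)).
- intros y; symmetry; apply (Derive_n_chain n); [assumption | lia].
- exists (F (S k) x); apply HF; lia.
Qed.

Lemma class_C_chain (n : nat) (F : nat -> R -> R) :
  derivative_chain n F -> (forall x, continuous (F n) x) ->
  class_C n (F 0%nat).
Proof.
intros HF Cn k Hk x; split; [apply (ex_derive_n_chain n); assumption | ].
apply (continuous_ext (F k)).
- intros y; symmetry; apply (Derive_n_chain n); assumption.
- destruct (Nat.eq_dec k n) as [-> | Hne]; [apply Cn | ].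
  apply (ex_derive_continuous (F k)).
  exists (F (S k) x); apply HF; lia.
Qed.

(** * General criteria for convexity and for improper integrals *)

Lemma convex_of_second_derivative_nonneg (f f1 f2 : R -> R) :
  (forall x, is_derive f x (f1 x)) -> (forall x, is_derive f1 x (f2 x)) ->
  (forall x, 0 <= f2 x) -> convex_on_R f.
Proof.
intros D1 D2 H2.
assert (mvt : forall g g' : R -> R, (forall x, is_derive g x (g' x)) ->
  forall u v, exists c, Rmin u v <= c <= Rmax u v /\ g v - g u = g' c * (v - u)).
{ intros g g' Hg u v.
  destruct (MVT_gen g u v g') as [c Hc]; [now intros | | now exists c].
  intros x _; apply derivable_continuous_pt; exists (g' x).
  apply is_derive_Reals, Hg. }
(* The graph lies above its tangents: two mean value steps give [f u = f z + f1 z * (u - z) + f2 d *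
   (c - z) * (u - z)], and [c] lies between [z] and [u], so the last term is nonnegative. *)
assert (tangent : forall z u, f z + f1 z * (u - z) <= f u).
{ intros z u.
  destruct (mvt f f1 D1 z u) as [c [Hc Ec]].
  destruct (mvt f1 f2 D2 z c) as [d [_ Ed]].
  assert (Hd := H2 d).
  assert (0 <= (c - z) * (u - z)).
  { destruct (Rle_dec z u).
    - rewrite Rmin_left, Rmax_right in Hc by lra; apply Rmult_le_pos; lra.
    - rewrite Rmin_right, Rmax_left in Hc by lra.
      replace ((c - z) * (u - z)) with ((z - c) * (z - u)) by ring.
      apply Rmult_le_pos; lra. }
  assert (0 <= f2 d * ((c - z) * (u - z))) by (apply Rmult_le_pos; assumption).
  replace (f u) with (f z + f1 c * (u - z)) by lra.
  replace (f1 c) with (f1 z + f2 d * (c - z)) by lra.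
  lra. }
intros x y t Ht.
set (z := t * x + (1 - t) * y).
assert (Hx := Rmult_le_compat_l t _ _ (proj1 Ht) (tangent z x)).
assert (Hy := Rmult_le_compat_l (1 - t) _ _ ltac:(lra) (tangent z y)).
(* The slope terms cancel because [t * (x - z) + (1 - t) * (y - z) = 0]. *)
replace (f z) with
  (t * (f z + f1 z * (x - z)) + (1 - t) * (f z + f1 z * (y - z)))
  by (unfold z; ring).
lra.
Qed.

(** Once the lower bound is below [a] and the upper bound above [b], the integral equals [l]
    exactly, so the limit is attained and [l] lies in each of its own neighbourhoods. *)
Lemma is_RInt_gen_compact_support (f : R -> R) (a b l : R) :
  (forall y, y < a -> f y = 0) -> (forall y, b < y -> f y = 0) ->
  a <= b -> is_RInt f a b l ->
  is_RInt_gen f (Rbar_locally m_infty) (Rbar_locally p_infty) l.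
Proof.
intros Ha Hb Hab Hf P HP.
apply (Filter_prod _ _ _ (fun u => u < a) (fun v => b < v));
  [now exists a | now exists b | ].
intros u v Hu Hv; exists l; split; [simpl | exact (locally_singleton _ _ HP)].
assert (zero : forall c d, c <= d -> (forall y, c < y < d -> f y = 0) ->
  is_RInt f c d 0).
{ intros c d Hcd H0.
  apply (is_RInt_ext (fun _ => 0)).
  - rewrite Rmin_left, Rmax_right by assumption.
    intros y Hy; symmetry; now apply H0.
  - exact (eq_ind _ (is_RInt (fun _ => 0) c d)
      (is_RInt_const (V := R_NormedModule) c d 0) _ (Rmult_0_r (d - c))). }
replace l with (plus (plus 0 l) 0) by (unfold plus; simpl; ring).
apply (is_RInt_Chasles (V := R_NormedModule)) with b.
- apply (is_RInt_Chasles (V := R_NormedModule)) with a; [ | assumption].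
  apply zero; [lra | intros; apply Ha; lra].
- apply zero; [lra | intros; apply Hb; lra].
Qed.

(** * Derivatives of the absolute value away from 0 *)

Definition signed_line (s : R) (k : nat) (x : R) : R :=
  match k with 0%nat => s * x | 1%nat => s | _ => 0 end.

Lemma signed_line_chain (s : R) (n : nat) : derivative_chain n (signed_line s).
Proof.
intros [ | [ | k]] x _; unfold signed_line; auto_derive; trivial; ring.
Qed.

Lemma Rabs_derivatives (s : R) (k : nat) (x : R) : s = 1 \/ s = -1 -> 0 < s * x ->
  ex_derive_n rho k x /\ Derive_n rho k x = signed_line s k x.
Proof.
intros Hs Hx.
(* [s] is the sign of [x]; it persists near [x], and derivatives depend only on local values. *)
assert (L : locally x (fun y => signed_line s 0 y = rho y)).
{ apply filter_imp with (P := fun y => 0 < s * y).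
  - intros y Hy; unfold rho; simpl; destruct Hs as [-> | ->].
    + rewrite Rabs_pos_eq; lra.
    + rewrite Rabs_left; lra.
  - destruct Hs as [-> | ->].
    + apply filter_imp with (2 := open_gt 0 x ltac:(lra)); intros; lra.
    + apply filter_imp with (2 := open_lt 0 x ltac:(lra)); intros; lra. }
split.
- apply (ex_derive_n_ext_loc (signed_line s 0)); [exact L | ].
  apply (ex_derive_n_chain k); [apply signed_line_chain | lia].
- rewrite <- (Derive_n_ext_loc (signed_line s 0)) by exact L.
  apply (Derive_n_chain k); [apply signed_line_chain | lia].
Qed.

(** * The explicit piecewise function and its derivatives *)

(** The sextic and its first three derivatives; indices above 3 merely repeat the third. Order 2 is
    kept factored as twice the kernel polynomial. *)
Definition core (eps : R) (k : nat) (x : R) : R :=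
  match k with
  | 0%nat => 5 * eps / 16 + 15 * x ^ 2 / (16 * eps)
             - 5 * x ^ 4 / (16 * eps ^ 3) + x ^ 6 / (16 * eps ^ 5)
  | 1%nat => 15 * x / (8 * eps) - 5 * x ^ 3 / (4 * eps ^ 3)
             + 3 * x ^ 5 / (8 * eps ^ 5)
  | 2%nat => 15 / (8 * eps) * (1 - (x / eps) ^ 2) ^ 2
  | _ => - (15 * x / (2 * eps ^ 3)) * (1 - (x / eps) ^ 2)
  end.

Definition smooth_abs (eps : R) (k : nat) : R -> R :=
  glue (- eps) (signed_line (-1) k) (glue eps (core eps k) (signed_line 1 k)).

Section Smoothing.

Variable eps : R.
Hypothesis heps : 0 < eps.

Lemma core_chain : derivative_chain 3 (core eps).
Proof.
intros [ | [ | [ | k]]] x Hk; [ | | | lia]; unfold core; auto_derive; trivial;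
  field; lra.
Qed.

(** The coefficients add up to 16/16 at order 0 and 8/8 at order 1; orders 2 and 3 carry the factor
    [1 - (x / eps) ^ 2], which vanishes at both junctions. *)
Lemma core_at_eps (k : nat) : (k <= 3)%nat -> core eps k eps = signed_line 1 k eps.
Proof.
intros Hk; destruct k as [ | [ | [ | [ | k]]]]; [ | | | | lia]; simpl; field; lra.
Qed.

Lemma core_at_neg_eps (k : nat) : (k <= 3)%nat ->
  core eps k (- eps) = signed_line (-1) k (- eps).
Proof.
intros Hk; destruct k as [ | [ | [ | [ | k]]]]; [ | | | | lia]; simpl; field; lra.
Qed.

Lemma smooth_abs_left (k : nat) (x : R) : x <= - eps ->
  smooth_abs eps k x = signed_line (-1) k x.
Proof. intros H; unfold smooth_abs; apply glue_left, H. Qed.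

Lemma smooth_abs_mid (k : nat) (x : R) : (k <= 3)%nat -> - eps <= x <= eps ->
  smooth_abs eps k x = core eps k x.
Proof.
intros Hk [[H | <-] H']; unfold smooth_abs.
- rewrite glue_right, glue_left; trivial.
(* At [- eps] the outer [glue] selects the line, so agreement of the pieces is needed. *)
- rewrite glue_left, core_at_neg_eps; trivial; lra.
Qed.

Lemma smooth_abs_right (k : nat) (x : R) : (k <= 3)%nat -> eps <= x ->
  smooth_abs eps k x = signed_line 1 k x.
Proof.
intros Hk [H | <-].
- unfold smooth_abs; rewrite !glue_right; trivial; lra.
- rewrite smooth_abs_mid, core_at_eps; trivial; lra.
Qed.

(** Differentiating order [k] across a junction requires agreement at orders [k] and [k + 1]; for
    [k < 3] both are at most 3. *)
Lemma smooth_abs_chain : derivative_chain 3 (smooth_abs eps).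
Proof.
intros k x Hk; apply is_derive_glue.
- rewrite glue_left by lra; symmetry; apply core_at_neg_eps; lia.
- rewrite glue_left by lra; symmetry; apply core_at_neg_eps; lia.
- intros y; apply (signed_line_chain _ 3); lia.
- apply is_derive_glue; try (apply core_at_eps; lia).
  + intros y; apply core_chain; lia.
  + intros y; apply (signed_line_chain _ 3); lia.
Qed.

Lemma smooth_abs_3_continuous (x : R) : continuous (smooth_abs eps 3) x.
Proof.
apply continuous_glue.
- rewrite glue_left by lra; symmetry; apply core_at_neg_eps; lia.
- intros y; apply continuous_const.
- apply continuous_glue.
  + apply core_at_eps; lia.
  + intros y; apply (ex_derive_continuous (core eps 3)); unfold core; auto_derive; lra.
  + intros y; apply continuous_const.
Qed.

(** This reflects that the distributional second derivative of |x| is twice the Dirac mass at 0. *)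
Lemma smooth_abs_2 (x : R) : smooth_abs eps 2 x = 2 * biweight eps x.
Proof.
unfold biweight; destruct (Rle_dec (Rabs x) eps) as [H | H].
- apply Rabs_le_between in H.
  rewrite smooth_abs_mid by (trivial; lia); simpl; field; lra.
- destruct (Rle_dec x (- eps)).
  + rewrite smooth_abs_left by assumption; simpl; ring.
  + destruct (Rle_dec eps x).
    * rewrite smooth_abs_right by (trivial; lia); simpl; ring.
    * exfalso; apply H, Rabs_le_between; lra.
Qed.

(** * The kernel and the evaluation of the convolution *)

Lemma biweight_nonneg (t : R) : 0 <= biweight eps t.
Proof.
unfold biweight; destruct (Rle_dec (Rabs t) eps); [ | lra].
apply Rmult_le_pos; [ | apply pow2_ge_0].
apply Rlt_le, Rdiv_lt_0_compat; lra.
Qed.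

(* An antiderivative of t |-> psi_eps(t) (x + t) on [-eps, eps]; as psi_eps is
   even, psi_eps(x - y) y is this integrand at t = y - x. *)
Definition moment_primitive (x t : R) : R :=
  15 / (16 * eps) *
  (x * (t - 2 * t ^ 3 / (3 * eps ^ 2) + t ^ 5 / (5 * eps ^ 4))
   + (t ^ 2 / 2 - t ^ 4 / (2 * eps ^ 2) + t ^ 6 / (6 * eps ^ 4))).

(** Inside the kernel's support, and with [y] of constant sign [s], the integrand is a polynomial,
    so the fundamental theorem of calculus applies. *)
Lemma is_RInt_conv_integrand_signed (s x a b : R) :
  s = 1 \/ s = -1 -> x - eps <= a -> a <= b -> b <= x + eps ->
  (forall y, a < y < b -> 0 <= s * y) ->
  is_RInt (conv_integrand eps x) a b
    (s * (moment_primitive x (b - x) - moment_primitive x (a - x))).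
Proof.
intros Hs Ha Hab Hb Hpos.
apply (is_RInt_ext
  (fun y => 15 / (16 * eps) * (1 - ((x - y) / eps) ^ 2) ^ 2 * (s * y))).
- rewrite Rmin_left, Rmax_right by assumption.
  intros y Hy; unfold conv_integrand, biweight, rho.
  destruct (Rle_dec (Rabs (x - y)) eps) as [_ | H].
  + specialize (Hpos y Hy); f_equal; destruct Hs as [-> | ->].
    * rewrite Rabs_pos_eq; lra.
    * rewrite Rabs_left1; lra.
  + exfalso; apply H, Rabs_le_between; lra.
- replace (s * (moment_primitive x (b - x) - moment_primitive x (a - x)))
    with (minus (s * moment_primitive x (b - x)) (s * moment_primitive x (a - x)))
    by (unfold minus, plus, opp; simpl; ring).
  apply (is_RInt_derive (fun y => s * moment_primitive x (y - x))).
  + intros y _; unfold moment_primitive; auto_derive; trivial; field; lra.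
  + intros y _; apply (ex_derive_continuous (V := R_NormedModule)).
    auto_derive; lra.
Qed.

(** For [x] outside the open interval from [- eps] to [eps], [y] keeps one sign on the window, and
    the result is [-x] or [x] since the kernel has mass 1 and first moment 0. *)
Lemma is_RInt_conv_integrand (x : R) :
  is_RInt (conv_integrand eps x) (x - eps) (x + eps) (smooth_abs eps 0 x).
Proof.
destruct (Rle_dec x (- eps)) as [H | H].
- rewrite smooth_abs_left by assumption.
  replace (signed_line (-1) 0 x) with
    (-1 * (moment_primitive x (x + eps - x) - moment_primitive x (x - eps - x)))
    by (unfold moment_primitive; simpl; field; lra).
  apply is_RInt_conv_integrand_signed; intros; lra.
- destruct (Rle_dec eps x) as [H' | H'].
  + rewrite smooth_abs_right by (trivial; lia).
    replace (signed_line 1 0 x) with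
      (1 * (moment_primitive x (x + eps - x) - moment_primitive x (x - eps - x)))
      by (unfold moment_primitive; simpl; field; lra).
    apply is_RInt_conv_integrand_signed; intros; lra.
  + rewrite smooth_abs_mid by (lia || lra).
    replace (core eps 0 x) with
      (plus (-1 * (moment_primitive x (0 - x) - moment_primitive x (x - eps - x)))
            (1 * (moment_primitive x (x + eps - x) - moment_primitive x (0 - x))))
      by (unfold moment_primitive, plus; simpl; field; lra).
    (* The window straddles 0, where |y| changes its formula, so it is split there. *)
    apply (is_RInt_Chasles (V := R_NormedModule)) with 0;
      apply is_RInt_conv_integrand_signed; intros; lra.
Qed.

Lemma is_RInt_gen_conv_integrand (x : R) :
  is_RInt_gen (conv_integrand eps x)
    (Rbar_locally m_infty) (Rbar_locally p_infty) (smooth_abs eps 0 x).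
Proof.
assert (zero : forall y, ~ (x - eps <= y <= x + eps) -> conv_integrand eps x y = 0).
{ intros y Hy; unfold conv_integrand, biweight.
  destruct (Rle_dec (Rabs (x - y)) eps) as [H | _]; [ | ring].
  apply Rabs_le_between in H; lra. }
apply (is_RInt_gen_compact_support _ (x - eps) (x + eps)).
- intros y Hy; apply zero; lra.
- intros y Hy; apply zero; lra.
- lra.
- apply is_RInt_conv_integrand.
Qed.

Lemma rho_tilde_eq (x : R) : rho_tilde eps x = smooth_abs eps 0 x.
Proof. apply is_RInt_gen_unique, is_RInt_gen_conv_integrand. Qed.

(** * Derivatives of the smoothed function and contact with |x| *)

Lemma Derive_n_rho_tilde (k : nat) (x : R) : (k <= 3)%nat ->
  Derive_n (rho_tilde eps) k x = smooth_abs eps k x.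
Proof.
intros Hk; rewrite (Derive_n_ext _ _ k x rho_tilde_eq).
apply (Derive_n_chain 3); [apply smooth_abs_chain | assumption].
Qed.

Lemma ex_derive_n_rho_tilde (k : nat) (x : R) : (k <= 3)%nat ->
  ex_derive_n (rho_tilde eps) k x.
Proof.
intros Hk; apply (ex_derive_n_ext (smooth_abs eps 0)).
- intros y; symmetry; apply rho_tilde_eq.
- apply (ex_derive_n_chain 3); [apply smooth_abs_chain | assumption].
Qed.

Lemma rho_tilde_matches (s : R) : s = 1 \/ s = -1 ->
  matches_to_order 3 (rho_tilde eps) rho (s * eps).
Proof.
intros Hs; split.
(* This open half-line contains [s * eps] and avoids the kink of [rho] at 0. *)
- apply filter_imp with (P := fun y => 0 < s * y).
  + intros y Hy k Hk; split; [now apply ex_derive_n_rho_tilde | ].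
    now apply (Rabs_derivatives s).
  + destruct Hs as [-> | ->].
    * apply filter_imp with (2 := open_gt 0 (1 * eps) ltac:(lra)); intros; lra.
    * apply filter_imp with (2 := open_lt 0 (-1 * eps) ltac:(lra)); intros; lra.
- intros k Hk; rewrite Derive_n_rho_tilde by assumption.
  destruct (Rabs_derivatives s k (s * eps) Hs) as [_ ->].
  + destruct Hs as [-> | ->]; lra.
  + destruct Hs as [-> | ->].
    * apply smooth_abs_right; [assumption | lra].
    * apply smooth_abs_left; lra.
Qed.

End Smoothing.

Theorem proposition4 (eps : R) (heps : 0 < eps) :
  (forall x : R,
     ex_RInt_gen (conv_integrand eps x)
       (Rbar_locally m_infty) (Rbar_locally p_infty)) /\
  (forall x : R, Rabs x < eps ->
     rho_tilde eps x =
       5 * eps / 16 + 15 * x ^ 2 / (16 * eps)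
       - 5 * x ^ 4 / (16 * eps ^ 3) + x ^ 6 / (16 * eps ^ 5)) /\
  (forall x : R, eps <= Rabs x -> rho_tilde eps x = Rabs x) /\
  class_C 3 (rho_tilde eps) /\
  convex_on_R (rho_tilde eps) /\
  matches_to_order 3 (rho_tilde eps) rho eps /\
  matches_to_order 3 (rho_tilde eps) rho (- eps) /\
  (rho_tilde eps 0 = 5 / 16 * eps /\ 5 / 16 * eps > 0) /\
  Derive_n (rho_tilde eps) 1 0 = 0 /\
  (Derive_n (rho_tilde eps) 2 0 = 15 / (8 * eps) /\ 15 / (8 * eps) > 0) /\
  (forall x : R,
     Derive_n (rho_tilde eps) 2 x = 2 * biweight eps x /\
     2 * biweight eps x >= 0).
Proof.
split; [ | split; [ | split; [ | split; [ | split; [ | split;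
  [ | split; [ | split; [ | split; [ | split]]]]]]]]].
- intros x; exists (smooth_abs eps 0 x); now apply is_RInt_gen_conv_integrand.
- intros x Hx; apply Rabs_lt_between in Hx.
  now rewrite rho_tilde_eq, smooth_abs_mid by (lia || lra).
- intros x Hx; rewrite rho_tilde_eq by assumption.
  revert Hx; unfold Rabs; destruct (Rcase_abs x); intros Hx.
  + rewrite smooth_abs_left by lra; simpl; ring.
  + rewrite smooth_abs_right by (lia || lra); simpl; ring.
- intros k Hk x; split; [now apply ex_derive_n_rho_tilde | ].
  apply (continuous_ext (Derive_n (smooth_abs eps 0) k)).
  + intros y; apply Derive_n_ext; intros z; symmetry; now apply rho_tilde_eq.
  + apply (class_C_chain 3); trivial.
    * now apply smooth_abs_chain.
    * now apply smooth_abs_3_continuous.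
- intros x y t Ht; rewrite !rho_tilde_eq by assumption; revert x y t Ht.
  apply (convex_of_second_derivative_nonneg _ (smooth_abs eps 1) (smooth_abs eps 2)).
  + intros x; apply smooth_abs_chain; [assumption | lia].
  + intros x; apply smooth_abs_chain; [assumption | lia].
  + intros x; rewrite smooth_abs_2 by assumption.
    generalize (biweight_nonneg eps heps x); lra.
(* The second occurrence of [eps] is the contact point; the first is the smoothing parameter and
   stays as it is. *)
- rewrite <- (Rmult_1_l eps) at 2; apply rho_tilde_matches; lra.
- replace (- eps) with (-1 * eps) by ring; apply rho_tilde_matches; lra.
- split; [ | lra].
  rewrite rho_tilde_eq, smooth_abs_mid by (lia || lra); simpl; field; lra.
- rewrite Derive_n_rho_tilde, smooth_abs_mid by (lia || lra); simpl; field; lra.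
- split; [ | apply Rdiv_lt_0_compat; lra].
  rewrite Derive_n_rho_tilde, smooth_abs_mid by (lia || lra); simpl; field; lra.
- intros x; split.
  + rewrite Derive_n_rho_tilde by (assumption || lia); now apply smooth_abs_2.
  + generalize (biweight_nonneg eps heps x); lra.
Qed.
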